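(* Any Einstein cokähler manifold $(M,\alpha,\omega,g)$ is Ricci-flat.
   Context: An almost contact metric structure $(\alpha,\omega,g)$ on a $(2n+1)$-dimensional manifold $M$ consists of a $1$-form $\alpha$, a $2$-form $\omega$ and a Riemannian metric $g$ such that near each point there is an orthonormal coframe $e^1,\dots,e^{2n+1}$ with $\alpha=e^{2n+1}$ and $\omega=e^{1}\wedge e^2+e^3\wedge e^4+\dots+e^{2n-1}\wedge e^{2n}$. It is cokähler if $\alpha$ and $\omega$ are both parallel for the Levi-Civita connection of $g$. It is Einstein if $\mathrm{Ric}=\tau g$ with $\tau$ constant. The manifold is not assumed to be compact. *)

(* Defs.v *)
From HB Require Import structures.
From mathcomp Require Import all_boot all_order all_algebra.
From mathcomp Require Import all_classical all_reals all_analysis.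
Set Implicit Arguments.
Unset Strict Implicit.
Unset Printing Implicit Defensive.
Import Order.TTheory GRing.Theory Num.Theory numFieldNormedType.Exports.
Local Open Scope classical_set_scope.
Local Open Scope ring_scope.

(* Tensor fields and connections on a smooth manifold are given by their
   components in the charts of an atlas, subject to the usual transformation
   laws.  Components are functions of the coordinates x : 'rV_m; only their
   values on the image of the chart are meaningful. *)

Section Calculus.
Context {R : realType} {m : nat}.
Implicit Types (U : set 'rV[R]_m) (f : 'rV[R]_m -> R).

Definition partial (i : 'I_m) f : 'rV[R]_m -> R :=
  fun x => 'D_(delta_mx 0 i) f x.

Definition iter_partial (s : seq 'I_m) f : 'rV[R]_m -> R := foldr partial f s.

(* Meant for open U: C^oo on U. *)
Definition smooth_on U f := forall (s : seq 'I_m) x, U x ->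
  {for x, continuous (iter_partial s f)} /\
  forall i, derivable (iter_partial s f) x (delta_mx 0 i).

End Calculus.

Record chart (R : realType) (m : nat) (M : topologicalType) := Chart {
  cdom : set M;
  coord : M -> 'rV[R]_m;
  param : 'rV[R]_m -> M;
  cdom_open : open cdom;
  cimg_open : open (coord @` cdom);
  coordK : forall p, cdom p -> param (coord p) = p;
  coord_continuous : forall p, cdom p -> {for p, continuous coord};
  param_continuous :
    forall x, (coord @` cdom) x -> {for x, continuous param} }.

Section Charts.
Context {R : realType} {m : nat} {M : topologicalType}.
Implicit Types c d : chart R m M.

Definition cimg c : set 'rV[R]_m := coord c @` cdom c.

Definition overlap c d : set 'rV[R]_m := coord c @` (cdom c `&` cdom d).

Definition transition c d : 'rV[R]_m -> 'rV[R]_m := coord d \o param c.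

(* Entry (i, j) is dy^j / dx^i, where x and y are the coordinates of c and d. *)
Definition jac c d (x : 'rV[R]_m) : 'M[R]_m :=
  \matrix_(i, j) partial i (fun z => transition c d z 0 j) x.

End Charts.

Record manifold (R : realType) (m : nat) := Manifold {
  points :> topologicalType;
  manifold_hausdorff : hausdorff_space points;
  manifold_second_countable : @second_countable points;
  atlas : set (chart R m points);
  atlas_cover : forall p : points, exists2 c, atlas c & cdom c p;
  atlas_smooth : forall c d, atlas c -> atlas d ->
    forall j, smooth_on (overlap c d) (fun x => transition c d x 0 j) }.

Section Tensors.
Context {R : realType} {m : nat}.

Record one_form (M : manifold R m) := OneForm {
  form1 :> chart R m M -> 'rV[R]_m -> 'rV[R]_m;
  form1_smooth : forall c, atlas c ->
    forall i, smooth_on (cimg c) (fun x => form1 c x 0 i);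
  form1_transition : forall c d, atlas c -> atlas d ->
    forall x, overlap c d x ->
    form1 c x = form1 d (transition c d x) *m (jac c d x)^T }.

(* T c x i j is the value of T on the i-th and j-th coordinate vectors of c. *)
Record tensor02 (M : manifold R m) := Tensor02 {
  tensor :> chart R m M -> 'rV[R]_m -> 'M[R]_m;
  tensor_smooth : forall c, atlas c ->
    forall i j, smooth_on (cimg c) (fun x => tensor c x i j);
  tensor_transition : forall c d, atlas c -> atlas d ->
    forall x, overlap c d x ->
    tensor c x = jac c d x *m tensor d (transition c d x) *m (jac c d x)^T }.

Record two_form (M : manifold R m) := TwoForm {
  form2 :> tensor02 M;
  form2_skew : forall c, atlas c -> forall x, cimg c x ->
    (form2 c x)^T = - form2 c x }.

Record riemannian_metric (M : manifold R m) := RiemannianMetric {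
  metric :> tensor02 M;
  metric_sym : forall c, atlas c -> forall x, cimg c x ->
    (metric c x)^T = metric c x;
  metric_pos : forall c, atlas c -> forall x, cimg c x ->
    forall v : 'rV[R]_m, v != 0 -> 0 < (v *m metric c x *m v^T) 0 0 }.

(* Gamma c x k i j is the Christoffel symbol Gamma^k_ij in the chart c:
   nabla_(d_i) d_j = sum_k Gamma^k_ij d_k. *)
Record connection (M : manifold R m) := Connection {
  Gamma :> chart R m M -> 'rV[R]_m -> 'I_m -> 'I_m -> 'I_m -> R;
  Gamma_smooth : forall c, atlas c ->
    forall k i j, smooth_on (cimg c) (fun x => Gamma c x k i j);
  Gamma_transition : forall c d, atlas c -> atlas d ->
    forall x, overlap c d x -> forall k i j,
    \sum_l Gamma c x l i j * jac c d x l k =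
    iter_partial [:: i; j] (fun z => transition c d z 0 k) x +
    \sum_a \sum_b jac c d x i a * jac c d x j b
                  * Gamma d (transition c d x) k a b }.

Section Geometry.
Variable M : manifold R m.
Implicit Types (D : connection M) (a : one_form M) (T : tensor02 M)
  (g : riemannian_metric M) (c : chart R m M).

(* (nabla_(d_i) a)(d_j) *)
Definition nabla1 D a c (x : 'rV[R]_m) (i j : 'I_m) : R :=
  partial i (fun z => a c z 0 j) x - \sum_k D c x k i j * a c x 0 k.

(* (nabla_(d_i) T)(d_j, d_k) *)
Definition nabla2 D T c (x : 'rV[R]_m) (i j k : 'I_m) : R :=
  partial i (fun z => T c z j k) x
  - \sum_l D c x l i j * T c x l k - \sum_l D c x l i k * T c x j l.

Definition parallel1 D a := forall c, atlas c -> forall x, cimg c x ->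
  forall i j, nabla1 D a c x i j = 0.

Definition parallel2 D T := forall c, atlas c -> forall x, cimg c x ->
  forall i j k, nabla2 D T c x i j k = 0.

Definition torsion_free D := forall c, atlas c -> forall x, cimg c x ->
  forall k i j, D c x k i j = D c x k j i.

Definition levi_civita g D := torsion_free D /\ parallel2 D g.

(* Component R^l_kij of the curvature: R(d_i, d_j) d_k = sum_l R^l_kij d_l, with
   R(X, Y) = nabla_X nabla_Y - nabla_Y nabla_X - nabla_[X, Y]. *)
Definition curvature D c (x : 'rV[R]_m) (l k i j : 'I_m) : R :=
  partial i (fun z => D c z l j k) x - partial j (fun z => D c z l i k) x
  + \sum_a (D c x l i a * D c x a j k - D c x l j a * D c x a i k).

(* Ric(Y, Z) = tr (X |-> R(X, Y) Z) *)
Definition ricci D c (x : 'rV[R]_m) : 'M[R]_m :=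
  \matrix_(j, k) \sum_i curvature D c x i k i j.

Definition einstein g D := exists tau : R,
  forall c, atlas c -> forall x, cimg c x -> ricci D c x = tau *: g c x.

Definition ricci_flat D :=
  forall c, atlas c -> forall x, cimg c x -> ricci D c x = 0.

End Geometry.

(* Inner product induced on covectors by the Gram matrix G of a basis. *)
Definition coinner (G : 'M[R]_m) (a b : 'rV[R]_m) : R :=
  (a *m invmx G *m b^T) 0 0.

(* Matrix of (u, v) |-> a(u) b(v) - a(v) b(u). *)
Definition wedge (a b : 'rV[R]_m) : 'M[R]_m := a^T *m b - b^T *m a.

End Tensors.

Section AlmostContact.
Context {R : realType} {n : nat} {M : manifold R n.*2.+1}.
Implicit Types (alpha : one_form M) (omega : two_form M)
  (g : riemannian_metric M).

(* Indices are shifted by one: e^1, ..., e^(2n+1) are e 0, ..., e (2n). *)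
Definition almost_contact_metric alpha omega g := forall p : M,
  exists2 c, atlas c & cdom c p /\
  exists (U : set 'rV[R]_(n.*2.+1))
         (e : 'I_(n.*2.+1) -> 'rV[R]_(n.*2.+1) -> 'rV[R]_(n.*2.+1)),
  [/\ open U, U (coord c p), U `<=` cimg c,
      forall i j, smooth_on U (fun x => e i x 0 j) &
      forall x, U x ->
      [/\ forall i j, coinner (g c x) (e i x) (e j x) = (i == j)%:R,
          alpha c x = e ord_max x &
          omega c x = \sum_(k < n) wedge (e (inord k.*2) x)
                                         (e (inord k.*2.+1) x)]].

Definition cokahler alpha omega g (D : connection M) :=
  [/\ almost_contact_metric alpha omega g, parallel1 D alpha
    & parallel2 D omega].

End AlmostContact.

(* Main.v *)
(** The vector field v dual to the parallel unit form alpha is parallel, hence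
    annihilated by the curvature, so Ric(-, v) = 0.  If Ric = tau g, then
    tau = tau g(v, v) = Ric(v, v) = 0. *)

Require Import Defs.
From mathcomp Require Import all_boot all_order all_algebra.
From mathcomp Require Import all_classical all_reals all_analysis.
From mathcomp Require Import ring lra.
Set Implicit Arguments.
Unset Strict Implicit.
Unset Printing Implicit Defensive.
Import Order.TTheory GRing.Theory Num.Theory numFieldNormedType.Exports.
Local Open Scope classical_set_scope.
Local Open Scope ring_scope.

(** Write covectors as rows and let [K] be the curvature matrix in the directions [i], [j]. Since
    [alpha] is parallel and mixed partial derivatives commute, [K *m alpha^T = 0]
    ([curvature_mx_parallel1]). In the same way the parallel metric gives [K *m g + g *m K^T = 0]
    ([curvature_mx_parallel2]). Together they show that [K] annihilates the dual vector
    [v = alpha *m invmx g], without ever differentiating [v] or the inverse metric. Taking the trace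
    gives Ric(-, v) = 0 ([ricci_parallel_dual]). In the Einstein case tau g(v, v) = 0, and g(v, v) =
    1 because [alpha] belongs to an orthonormal coframe, so tau = 0. Both curvature identities are
    instances of [curvature_mx_parallel], whose analytic input is the symmetry of second derivatives
    ([derive_comm]). *)

Lemma dist_le_halves {R : realFieldType} (p q c e : R) :
  `|p - c| < e / 2 -> `|q - c| < e / 2 -> `|p - q| <= e.
Proof.
by rewrite !ltr_distl ler_distl => /andP[? ?] /andP[? ?]; apply/andP; split; lra.
Qed.

(** * Symmetry of mixed directional derivatives *)

Section Schwarz.
Context {R : realType} {V : normedModType R}.
Implicit Types (f : V -> R) (u v x : V).

Lemma is_derive_line f u x (t : R) : derivable f (t *: u + x) u ->
  is_derive t 1 (fun s : R => f (s *: u + x)) ('D_u f (t *: u + x)).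
Proof.
have E : (fun h : R => h^-1 *: (f ((h *: 1 + t) *: u + x) - f (t *: u + x))) =
    (fun h : R => h^-1 *: (f (h *: u + (t *: u + x)) - f (t *: u + x))).
  by apply/funext => h; rewrite [h *: 1]mulr1 scalerDl addrA.
move=> df; have [] : derivable (fun s : R => f (s *: u + x)) t 1 /\
    'D_1 (fun s : R => f (s *: u + x)) t = 'D_u f (t *: u + x).
  by rewrite /derivable /derive /= E.
by move=> ? <-; apply: derivableP.
Qed.

(** The mean value theorem is applied twice: along [u] to the difference [phi] of [f] on two
    opposite sides of the parallelogram, then along [v] to ['D_u f]. *)
Lemma second_difference f u v x (s : R) : 0 < s ->
  (forall a b : R, 0 <= a <= s -> 0 <= b <= s ->
    derivable f (a *: u + (b *: v + x)) u /\
    derivable ('D_u f) (a *: u + (b *: v + x)) v) ->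
  exists a b : R, [/\ 0 <= a <= s, 0 <= b <= s &
    f (s *: u + (s *: v + x)) - f (s *: u + x) - f (s *: v + x) + f x =
    'D_v ('D_u f) (a *: u + (b *: v + x)) * s ^+ 2].
Proof.
move=> s0 df; have s0' := ltW s0.
have E0 w c : 0 *: w + c = c :> V by rewrite scale0r add0r.
pose phi (a : R) := f (a *: u + (s *: v + x)) - f (a *: u + x).
pose dphi (a : R) := 'D_u f (a *: u + (s *: v + x)) - 'D_u f (a *: u + x).
have dp a : 0 <= a <= s -> is_derive a 1 phi (dphi a).
  move=> ha; apply: is_deriveB.
    by apply: is_derive_line; apply: (proj1 (df a s ha _)); rewrite s0' lexx.
  apply: is_derive_line; rewrite -(E0 v x).
  by apply: (proj1 (df a 0 ha _)); rewrite lexx s0'.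
have [a] : exists2 a, a \in `[0, s]%R & phi s - phi 0 = dphi a * (s - 0).
  apply: (@MVT_segment R phi dphi 0 s s0').
    by move=> a; rewrite in_itv/= => /andP[/ltW ? /ltW ?]; apply: dp; apply/andP.
  by apply: derivable_within_continuous => a; rewrite in_itv/= => /dp [].
rewrite in_itv/= => ha; rewrite subr0 => Ea.
pose psi (b : R) := 'D_u f (b *: v + (a *: u + x)).
pose dpsi (b : R) := 'D_v ('D_u f) (b *: v + (a *: u + x)).
have dq b : 0 <= b <= s -> is_derive b 1 psi (dpsi b).
  move=> hb; apply: is_derive_line; rewrite addrCA.
  exact: (proj2 (df a b ha hb)).
have [b] : exists2 b, b \in `[0, s]%R & psi s - psi 0 = dpsi b * (s - 0).
  apply: (@MVT_segment R psi dpsi 0 s s0').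
    by move=> b; rewrite in_itv/= => /andP[/ltW ? /ltW ?]; apply: dq; apply/andP.
  by apply: derivable_within_continuous => b; rewrite in_itv/= => /dq [].
rewrite in_itv/= => hb; rewrite subr0 => Eb.
exists a, b; split=> //.
have Epsi0 : psi 0 = 'D_u f (a *: u + x) by rewrite /psi E0.
have -> : 'D_v ('D_u f) (a *: u + (b *: v + x)) * s ^+ 2 = phi s - phi 0.
  have -> : phi s - phi 0 = (psi s - psi 0) * s.
    by rewrite Ea /dphi Epsi0 /psi [a *: u + (_ + _)]addrCA.
  by rewrite Eb /dpsi [b *: v + (_ + _)]addrCA expr2 mulrA.
rewrite /phi !E0; ring.
Qed.

(** The second difference of [f] is symmetric in [u] and [v], so [second_difference] in both orders
    makes a value of ['D_v ('D_u f)] near [x] equal to a value of ['D_u ('D_v f)] near [x]. By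
    continuity each is within [e / 2] of its value at [x]. *)
Lemma derive_comm f u v x :
  (\forall y \near x, [/\ derivable f y u, derivable f y v,
    derivable ('D_u f) y v & derivable ('D_v f) y u]) ->
  {for x, continuous ('D_u ('D_v f))} ->
  {for x, continuous ('D_v ('D_u f))} ->
  'D_u ('D_v f) x = 'D_v ('D_u f) x.
Proof.
move=> nx cu cv; apply/eqP; rewrite -subr_eq0 -normr_le0; apply/ler_addgt0Pr => e e0.
have e2 : 0 < e / 2 by rewrite divr_gt0.
move/cvgrPdist_lt: cu => /(_ _ e2) cu; move/cvgrPdist_lt: cv => /(_ _ e2) cv.
have /nbhs_ballP[r /= r0 hr] : \forall y \near x,
    [/\ derivable f y u, derivable f y v,
        derivable ('D_u f) y v & derivable ('D_v f) y u] /\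
    (`|'D_u ('D_v f) x - 'D_u ('D_v f) y| < e / 2 /\
     `|'D_v ('D_u f) x - 'D_v ('D_u f) y| < e / 2).
  by apply: filterI nx _; exact: filterI cu cv.
(* Since [s * K = r / 2], the whole parallelogram of side parameter [s] lies in the ball of radius
   [r]; the summand 1 keeps [K] positive when [u] and [v] vanish. *)
pose K := `|u| + `|v| + 1; pose s := r / (2 * K).
have K0 : 0 < K by rewrite ltr_wpDl// addr_ge0.
have s0 : 0 < s by rewrite divr_gt0// mulr_gt0.
have hs (a b : R) : 0 <= a <= s -> 0 <= b <= s -> ball x r (a *: u + (b *: v + x)).
  move=> /andP[a0 la] /andP[b0 lb]; rewrite -ball_normE /ball_ /=.
  rewrite addrA opprD addrCA subrr addr0 normrN.
  rewrite (le_lt_trans (ler_normD _ _))// !normrZ !ger0_norm//.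
  have h1 : a * `|u| <= s * `|u| by rewrite ler_wpM2r.
  have h2 : b * `|v| <= s * `|v| by rewrite ler_wpM2r.
  have h3 : s * K = r / 2 by rewrite /s; field; rewrite gt_eqF.
  have h4 : s * K = s * `|u| + s * `|v| + s by rewrite /K; ring.
  lra.
have [a [b [ha hb E1]]] : exists a b : R, [/\ 0 <= a <= s, 0 <= b <= s &
    f (s *: u + (s *: v + x)) - f (s *: u + x) - f (s *: v + x) + f x =
    'D_v ('D_u f) (a *: u + (b *: v + x)) * s ^+ 2].
  apply: second_difference => // a b ha hb.
  by have [[d1 _ d2 _] _] := hr _ (hs a b ha hb); exact: conj d1 d2.
have [b' [a' [hb' ha' E2]]] : exists b a : R, [/\ 0 <= b <= s, 0 <= a <= s &
    f (s *: v + (s *: u + x)) - f (s *: v + x) - f (s *: u + x) + f x =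
    'D_u ('D_v f) (b *: v + (a *: u + x)) * s ^+ 2].
  apply: second_difference => // b1 a1 hb1 ha1.
  rewrite (addrCA (b1 *: v) (a1 *: u) x).
  by have [[_ d1 _ d2] _] := hr _ (hs a1 b1 ha1 hb1); exact: conj d1 d2.
have E : 'D_v ('D_u f) (a *: u + (b *: v + x)) =
         'D_u ('D_v f) (b' *: v + (a' *: u + x)).
  have s2 : s ^+ 2 != 0 by rewrite expf_neq0// gt_eqF.
  apply: (mulIf s2); apply: etrans (esym E1) (etrans _ E2).
  rewrite (addrCA (s *: v) (s *: u) x); congr (_ + _); exact: addrAC.
have [_ [_ B1]] := hr _ (hs a b ha hb).
have [_ [B2 _]] := hr _ (hs a' b' ha' hb').
rewrite (addrCA (a' *: u) (b' *: v) x) in B2.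
rewrite E in B1.
rewrite [leRHS]add0r; exact: dist_le_halves B2 B1.
Qed.
End Schwarz.

Lemma partial_comm {R : realType} {m : nat} (U : set 'rV[R]_m) (f : 'rV[R]_m -> R)
    (i j : 'I_m) (x : 'rV[R]_m) :
  open U -> smooth_on U f -> U x ->
  partial i (partial j f) x = partial j (partial i f) x.
Proof.
move=> oU sf Ux; apply: derive_comm.
- have : \forall y \near x, U y by exact: open_nbhs_nbhs.
  apply: filterS => y Uy; split.
  + exact: (sf [::] y Uy).2.
  + exact: (sf [::] y Uy).2.
  + exact: (sf [:: i] y Uy).2.
  + exact: (sf [:: j] y Uy).2.
- exact: (sf [:: i; j] x Ux).1.
- exact: (sf [:: j; i] x Ux).1.
Qed.

(** The hypothesis is the equality of the two mixed second derivatives of a parallel [T], expanded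
    by the product rule. The cross terms [Gj *m T *m Hi^T] and [Gi *m T *m Hj^T] occur on both sides
    and cancel. *)
Lemma curvature_algebra {R : realFieldType} p q (T : 'M[R]_(p, q))
    (Gi Gj dG dG' : 'M[R]_p) (Hi Hj dH dH' : 'M[R]_q) :
  dG *m T + Gj *m (Gi *m T + T *m Hi^T) +
    ((Gi *m T + T *m Hi^T) *m Hj^T + T *m dH^T) =
  dG' *m T + Gi *m (Gj *m T + T *m Hj^T) +
    ((Gj *m T + T *m Hj^T) *m Hi^T + T *m dH'^T) ->
  (dG - dG' + (Gj *m Gi - Gi *m Gj)) *m T +
    T *m (dH - dH' + (Hj *m Hi - Hi *m Hj))^T = 0.
Proof.
rewrite !(raddfD, raddfN) /= !trmx_mul.
rewrite !(mulmxDl, mulmxDr, mulNmx, mulmxN) !mulmxA.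
move=> /matrixP comm; apply/matrixP => a b; move: (comm a b).
(* Once the ten distinct products are generalized, the claim is linear in their entries. *)
do 10!move: (_ *m _) => ?.
by rewrite ![in X in X -> _]mxE ![in X in _ -> X]mxE; lra.
Qed.

(** * Calculus of matrix-valued functions and curvature of parallel sections *)

Section MatrixCalculus.
Context {R : realType} {m : nat}.
Implicit Types (U : set 'rV[R]_m) (x : 'rV[R]_m).

Definition partial_mx p q (i : 'I_m) (A : 'rV[R]_m -> 'M[R]_(p, q)) x :
    'M[R]_(p, q) :=
  \matrix_(a, b) partial i (fun z => A z a b) x.

Definition derivable_mx p q (A : 'rV[R]_m -> 'M[R]_(p, q)) x :=
  forall i a b, derivable (fun z => A z a b) x (delta_mx 0 i).

Definition smooth_mx p q U (A : 'rV[R]_m -> 'M[R]_(p, q)) :=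
  forall a b, smooth_on U (fun z => A z a b).

Lemma smooth_mx_derivable p q U (A : 'rV[R]_m -> 'M[R]_(p, q)) x :
  smooth_mx U A -> U x -> derivable_mx A x.
Proof. by move=> sA Ux i a b; exact: (sA a b [::] x Ux).2. Qed.

Lemma derivable_mx_mul p q r (A : 'rV[R]_m -> 'M[R]_(p, q))
    (B : 'rV[R]_m -> 'M[R]_(q, r)) x :
  derivable_mx A x -> derivable_mx B x -> derivable_mx (fun z => A z *m B z) x.
Proof.
move=> dA dB i a b.
have -> : (fun z => (A z *m B z) a b) =
    \sum_(c < q) ((fun z => A z a c) * (fun z => B z c b)).
  by apply/funext => z; rewrite mxE fct_sumE.
by apply: derivable_sum => c; exact: derivableM.
Qed.

Lemma partial_mx_mul p q r i (A : 'rV[R]_m -> 'M[R]_(p, q))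
    (B : 'rV[R]_m -> 'M[R]_(q, r)) x :
  derivable_mx A x -> derivable_mx B x ->
  partial_mx i (fun z => A z *m B z) x =
  partial_mx i A x *m B x + A x *m partial_mx i B x.
Proof.
move=> dA dB; apply/matrixP => a b; rewrite !mxE /partial.
have -> : (fun z => (A z *m B z) a b) =
    \sum_(c < q) ((fun z => A z a c) * (fun z => B z c b)).
  by apply/funext => z; rewrite mxE fct_sumE.
rewrite derive_sum => [|c]; last exact: derivableM.
rewrite -big_split; apply: eq_bigr => c _ /=.
by rewrite deriveM// !mxE addrC; congr (_ + _); rewrite [LHS]mulrC.
Qed.

Lemma partial_mxD p q i (A B : 'rV[R]_m -> 'M[R]_(p, q)) x :
  derivable_mx A x -> derivable_mx B x ->
  partial_mx i (fun z => A z + B z) x = partial_mx i A x + partial_mx i B x.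
Proof.
move=> dA dB; apply/matrixP => a b; rewrite !mxE /partial.
have -> : (fun z => (A z + B z) a b) = (fun z => A z a b) + (fun z => B z a b).
  by apply/funext => z; rewrite mxE.
exact: deriveD.
Qed.

Lemma partial_mx_tr p q i (A : 'rV[R]_m -> 'M[R]_(p, q)) x :
  partial_mx i (fun z => (A z)^T) x = (partial_mx i A x)^T.
Proof.
apply/matrixP => a b; rewrite !mxE; congr (partial i _ x).
by apply/funext => z; rewrite mxE.
Qed.

Lemma derivable_mx_tr p q (A : 'rV[R]_m -> 'M[R]_(p, q)) x :
  derivable_mx A x -> derivable_mx (fun z => (A z)^T) x.
Proof.
move=> dA i a b.
have -> : (fun z => (A z)^T a b) = (fun z => A z b a).
  by apply/funext => z; rewrite mxE.
exact: dA.
Qed.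

Lemma near_eq_partial_mx p q i (A B : 'rV[R]_m -> 'M[R]_(p, q)) x :
  (\forall z \near x, A z = B z) -> partial_mx i A x = partial_mx i B x.
Proof.
move=> AB; apply/matrixP => a b; rewrite !mxE; apply: near_eq_derive.
by apply: filterS AB => z ->.
Qed.

(* Row k of [G i x] holds the components of nabla_i of the k-th frame vector,
   so the composition of two derivatives multiplies matrices in reverse. *)
Definition curvature_mx p (G : 'I_m -> 'rV[R]_m -> 'M[R]_p) (i j : 'I_m) x :=
  partial_mx i (G j) x - partial_mx j (G i) x + (G j x *m G i x - G i x *m G j x).

(* Mixed partial derivatives of a parallel section commute, so curvature kills
   it. *)
Lemma curvature_mx_parallel p q U (G : 'I_m -> 'rV[R]_m -> 'M[R]_p)
    (H : 'I_m -> 'rV[R]_m -> 'M[R]_q) (T : 'rV[R]_m -> 'M[R]_(p, q)) i j x :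
  open U -> (forall k, derivable_mx (G k) x) -> (forall k, derivable_mx (H k) x) ->
  smooth_mx U T ->
  (forall k z, U z -> partial_mx k T z = G k z *m T z + T z *m (H k z)^T) ->
  U x -> curvature_mx G i j x *m T x + T x *m (curvature_mx H i j x)^T = 0.
Proof.
move=> oU dG dH sT dT Ux.
have dTx := smooth_mx_derivable sT Ux.
have second k l : partial_mx k (partial_mx l T) x =
    partial_mx k (G l) x *m T x + G l x *m (G k x *m T x + T x *m (H k x)^T) +
    ((G k x *m T x + T x *m (H k x)^T) *m (H l x)^T +
     T x *m (partial_mx k (H l) x)^T).
  (* The first-order equation holds on the open set [U], hence near [x], so it may be differentiated
     once more. *)
  rewrite (@near_eq_partial_mx _ _ k _ (fun z => G l z *m T z + T z *m (H l z)^T)).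
    have dHt := derivable_mx_tr (dH l).
    rewrite (partial_mxD _ (derivable_mx_mul (dG l) dTx) (derivable_mx_mul dTx dHt)).
    rewrite (partial_mx_mul _ (dG l) dTx) (partial_mx_mul _ dTx dHt).
    by rewrite partial_mx_tr (dT k x Ux).
  have : \forall z \near x, U z by exact: open_nbhs_nbhs.
  by apply: filterS => z Uz; rewrite dT.
have comm : partial_mx i (partial_mx j T) x = partial_mx j (partial_mx i T) x.
  apply/matrixP => a b; rewrite [LHS]mxE [RHS]mxE.
  have E k : (fun z => partial_mx k T z a b) = partial k (fun z => T z a b).
    by apply/funext => z; rewrite mxE.
  by rewrite !E; exact: partial_comm (sT a b) Ux.
by rewrite !second in comm; exact: curvature_algebra comm.
Qed.

End MatrixCalculus.

(** * Ricci curvature in the direction dual to a parallel 1-form *)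

Section RicciParallel.
Context {R : realType} {m : nat} (M : manifold R m).
Implicit Types (D : connection M) (a : one_form M) (g : riemannian_metric M)
  (c : chart R m M).

(** With the lower index as row, a form [a] is parallel when the derivative of [a^T] is [G *m a^T],
    and a tensor [T] when its derivative is [G *m T + T *m G^T]. *)
Definition connection_mx D c (i : 'I_m) (x : 'rV[R]_m) : 'M[R]_m :=
  \matrix_(j, l) D c x l i j.

Lemma derivable_connection_mx D c i x : atlas c -> cimg c x ->
  derivable_mx (connection_mx D c i) x.
Proof.
move=> Ac cx k j l.
have -> : (fun z => connection_mx D c i z j l) = (fun z => D c z l i j).
  by apply/funext => z; rewrite mxE.
exact: (Gamma_smooth D Ac l i j [::] cx).2.
Qed.

Lemma curvature_mxE D c x l k i j :
  curvature D c x l k i j = curvature_mx (connection_mx D c) i j x k l.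
Proof.
have E (p q r : 'I_m) :
    partial_mx p (connection_mx D c q) x k r = partial p (fun z => D c z r q k) x.
  rewrite [LHS]mxE; congr (partial p _ x).
  by apply/funext => z; rewrite mxE.
have S (p q : 'I_m) : (connection_mx D c p x *m connection_mx D c q x) k l =
    \sum_a D c x l q a * D c x a p k.
  by rewrite mxE; apply: eq_bigr => a _; rewrite !mxE mulrC.
have -> : curvature_mx (connection_mx D c) i j x k l =
    partial_mx i (connection_mx D c j) x k l - partial_mx j (connection_mx D c i) x k l
    + ((connection_mx D c j x *m connection_mx D c i x) k l
       - (connection_mx D c i x *m connection_mx D c j x) k l).
  rewrite /curvature_mx; do 2!move: (partial_mx _ _ _) => ?.
  by do 2!move: (_ *m _) => ?; rewrite !mxE.
by rewrite !E !S /curvature sumrB.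
Qed.

(** The column [a^T] is a section with [q = 1] whose column index carries the zero connection, so
    only the first curvature term survives. *)
Lemma curvature_mx_parallel1 D a c x i j : parallel1 D a ->
  atlas c -> cimg c x ->
  curvature_mx (connection_mx D c) i j x *m (a c x)^T = 0.
Proof.
move=> pa Ac cx.
have := @curvature_mx_parallel R m m 1 (cimg c) (connection_mx D c)
  (fun _ _ => 0) (fun z => (a c z)^T) i j x (@cimg_open R m M c)
  (fun k => derivable_connection_mx (D := D) (i := k) Ac cx).
have -> : curvature_mx (fun=> fun=> 0 : 'M[R]_1) i j x = 0.
  have E k : partial_mx k (fun=> 0 : 'M[R]_1) x = 0.
    by apply/matrixP => p q; rewrite !mxE; exact: derive_cst.
  by rewrite /curvature_mx !E mulmx0 !subr0 addr0.
rewrite trmx0 mulmx0 addr0; apply => //.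
- by move=> k l p q; exact: derivable_cst.
- move=> p q.
  have -> : (fun z => (a c z)^T p q) = (fun z => a c z 0 p).
    by apply/funext => z; rewrite mxE ord1.
  exact: form1_smooth.
- move=> k z cz; rewrite mulmx0 addr0; apply/matrixP => p q.
  rewrite [LHS]mxE.
  have -> : (fun y => (a c y)^T p q) = (fun y => a c y 0 p).
    by apply/funext => y; rewrite mxE ord1.
  have /eqP := pa c Ac z cz k p; rewrite subr_eq0 => /eqP ->.
  by rewrite mxE; apply: eq_bigr => l _; rewrite !mxE ord1.
Qed.

Lemma curvature_mx_parallel2 D (T : tensor02 M) c x i j : parallel2 D T ->
  atlas c -> cimg c x ->
  curvature_mx (connection_mx D c) i j x *m T c x +
  T c x *m (curvature_mx (connection_mx D c) i j x)^T = 0.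
Proof.
move=> pT Ac cx.
have dG k := derivable_connection_mx (D := D) (i := k) Ac cx.
apply: (@curvature_mx_parallel R m m m (cimg c)) => //.
- exact: cimg_open.
- by move=> p q; exact: tensor_smooth.
- move=> k z cz; apply/matrixP => p q; rewrite [LHS]mxE.
  have /eqP := pT c Ac z cz k p q; rewrite /nabla2 -addrA -opprD subr_eq0 => /eqP ->.
  rewrite [RHS]mxE; congr (_ + _); rewrite mxE; apply: eq_bigr => l _.
    by rewrite !mxE.
  by rewrite !mxE mulrC.
Qed.

(** A nonzero row in the kernel would have length zero, against positivity. *)
Lemma metric_unitmx g c x : atlas c -> cimg c x -> g c x \in unitmx.
Proof.
move=> Ac cx; rewrite -row_free_unit -kermx_eq0; apply/eqP/row_matrixP => i.
rewrite row0; apply/eqP/negPn/negP => k0.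
have := metric_pos g Ac cx k0.
by rewrite -row_mul mulmx_ker row0 mul0mx mxE ltxx.
Qed.

Lemma ricci_parallel_dual g D a c x : parallel2 D g -> parallel1 D a ->
  atlas c -> cimg c x -> ricci D c x *m (a c x *m invmx (g c x))^T = 0.
Proof.
move=> pg pa Ac cx; have ug := metric_unitmx g Ac cx.
set v := a c x *m _.
(* Curvature matrices K satisfy [K g + g K^T = 0] and [K a^T = 0]; as
   [a^T = g v^T], this gives [g K^T v^T = 0]. *)
have vg : g c x *m v^T = (a c x)^T.
  by rewrite -{1}(Defs.metric_sym g Ac cx) -trmx_mul mulmxKV.
have Kv i j : v *m curvature_mx (connection_mx D c) i j x = 0.
  have := congr1 (mulmx^~ v^T) (curvature_mx_parallel2 i j pg Ac cx).
  rewrite /= mul0mx mulmxDl -[in X in X + _]mulmxA vg.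
  rewrite (curvature_mx_parallel1 i j pa Ac cx) add0r -mulmxA -trmx_mul => gK.
  by apply: trmx_inj; rewrite trmx0 -[LHS](mulKmx ug) gK mulmx0.
(* After exchanging the trace sum over [i] with the sum over [k], each summand is the [i]-th entry
   of [v] times the curvature matrix in directions [i], [j], which is zero by [Kv]. *)
apply/matrixP => j q; rewrite [RHS]mxE mxE.
under eq_bigr => k _.
  rewrite [ricci _ _ _ _ _]mxE mxE mulr_suml.
  under eq_bigr => i _ do rewrite curvature_mxE mulrC.
  over.
rewrite exchange_big big1//= => i _.
by have /matrixP/(_ q i) := Kv i j; rewrite mxE [RHS]mxE.
Qed.

End RicciParallel.

Theorem proposition3p2 (R : realType) (n : nat) (M : manifold R n.*2.+1)
    (alpha : one_form M) (omega : two_form M) (g : riemannian_metric M)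
    (nabla : connection M) :
  levi_civita g nabla ->
  cokahler alpha omega g nabla ->
  einstein g nabla ->
  ricci_flat nabla.
Proof.
move=> [_ pg] [acm pa _] [tau Etau] c Ac _ [p cp <-].
(* The adapted coframe lives in some chart [d] around [p], not in [c]. This suffices, since the
   constant [tau] is the same in all charts. *)
have [d Ad [dp [U [e [_ Up sU _ /(_ _ Up)[eo ae _]]]]]] := acm p.
set y := Defs.coord d p in Up eo ae; have dy : cimg d y by exact: sU.
have gu := metric_unitmx g Ad dy.
(* Pairing Ric(-, v) = 0 with [v] gives tau g(v, v) = 0, where g(v, v) is the squared norm of the
   covector [alpha], the last element of the orthonormal coframe. *)
have := congr1 (mulmx (alpha d y *m invmx (g d y)))
  (ricci_parallel_dual pg pa Ad dy).
rewrite (Etau d Ad _ dy) mulmx0 -scalemxAl -scalemxAr mulmxA mulmxKV//.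
have -> : alpha d y *m (alpha d y *m invmx (g d y))^T = 1%:M.
  rewrite -[LHS]trmxK trmx_mul trmxK [LHS]mx11_scalar mxE ae.
  by have := eo ord_max ord_max; rewrite /coinner eqxx => ->.
move/matrixP => /(_ 0 0).
rewrite !mxE eqxx mulr1n mulr1 => tau0.
by rewrite (Etau c Ac) ?tau0 ?scale0r//; exists p.
Qed.
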